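(* Let $n\ge1$, $0\le k<n$, and let $A,B\subseteq[n]$ with $|A|=|B|=k+1$. Then $$\mathrm{lm}_\preceq(\det M(A,B))=\prod_{(i,j)\in N(A,B)}x_{ij}.$$
   Context: $X=(x_{ij})_{1\le i,j\le n}$ is a matrix of indeterminates over a field $\mathbb K$. For $A,B\subseteq[n]$ of equal size, $M(A,B)=(x_{ij})_{i\in A,j\in B}$ is the corresponding submatrix. For $s\ge1$ and $A=\{a_1<\dots<a_s\}$, $B=\{b_1<\dots<b_s\}$, let $\ell$ be the least integer $0\le\ell\le s$ such that $a_{i+\ell}>b_i$ for all $1\le i\le s-\ell$. Then $N(A,B)=\{(a_{(i+\ell)\bmod s},b_i):i=1,\dots,s\}$, where $\bmod s$ takes values in $\{1,\dots,s\}$. Term order $\preceq$: let $\varphi(i,j)=\big[((2-i)n+(j-1)(n-1)-1)\bmod n^2\big]+1$, with the usual residue in $\{0,\dots,n^2-1\}$. This is a bijection $[n]^2\to[n^2]$. Order the variables by $x_{ij}\preceq x_{kl}$ iff $\varphi(i,j)\le\varphi(k,l)$. Then $\preceq$ is the degree reverse lexicographic order for this variable order: $m\prec m'$ if $\deg m<\deg m'$, or if the degrees are equal and, at the $\preceq$-smallest variable where the exponents differ, $m$ has the larger exponent. $\mathrm{lm}_\preceq(f)$ is the $\preceq$-largest monomial of $f$ with nonzero coefficient. *)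

(* Defs.v *)
From HB Require Import structures.
From mathcomp Require Import all_boot all_order all_algebra.
From mathcomp Require Import zify.
From mathcomp.multinomials Require Import mpoly.

Set Implicit Arguments.
Unset Strict Implicit.
Unset Printing Implicit Defensive.

Import Order.TTheory GRing.Theory Num.Theory.

Local Open Scope ring_scope.

(* Rows and columns are indexed from 0: the ordinal i : 'I_n stands for the
   index i + 1 of [n]. The indeterminate x_ij is the variable of
   {mpoly K[n * n]} of number mxvec_index i j. *)
Definition var n (i j : 'I_n) : 'I_(n * n) := mxvec_index i j.

Definition genmx_X (K : fieldType) n : 'M[{mpoly K[n * n]}]_n :=
  \matrix_(i, j) 'X_(var i j).

(* elt hA i is a_(i+1), where A = {a_1 < ... < a_s}; see elt_lt. *)
Definition elt n s (A : {set 'I_n}) (hA : #|A| = s) (i : 'I_s) : 'I_n :=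
  enum_val (cast_ord (esym hA) i).

Lemma elt_in n s (A : {set 'I_n}) (hA : #|A| = s) (i : 'I_s) : elt hA i \in A.
Proof. exact: enum_valP. Qed.

Lemma elt_lt n s (A : {set 'I_n}) (hA : #|A| = s) (i j : 'I_s) :
  (i < j)%N -> (elt hA i < elt hA j)%N.
Proof.
move=> ltij; rewrite /elt !(enum_val_nth (elt hA i)) /=.
have srt : sorted (fun x y : 'I_n => (x < y)%N) (enum A).
  rewrite /enum_mem; apply: sorted_filter; first by move=> x y z; apply: ltn_trans.
  by have := iota_ltn_sorted 0 n; rewrite -val_enum_ord sorted_map enumT.
apply: (sorted_ltn_nth _ _ srt) => //; first by move=> x y z; apply: ltn_trans.
- by rewrite inE -cardE hA.
- by rewrite inE -cardE hA.
Qed.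

Definition submat (K : fieldType) n s (A B : {set 'I_n})
    (hA : #|A| = s) (hB : #|B| = s) : 'M[{mpoly K[n * n]}]_s :=
  mxsub (elt hA) (elt hB) (genmx_X K n).

Definition good_shift n s (A B : {set 'I_n}) (hA : #|A| = s) (hB : #|B| = s)
    (l : nat) : bool :=
  (l <= s)%N &&
  [forall i : 'I_s, forall j : 'I_s,
     (j == i + l :> nat)%N ==> (elt hB i < elt hA j)%N].

Lemma good_shift_ex n s (A B : {set 'I_n}) (hA : #|A| = s) (hB : #|B| = s) :
  exists l, good_shift hA hB l.
Proof.
exists s; rewrite /good_shift leqnn /=.
apply/forallP => i; apply/forallP => j; apply/implyP => /eqP E.
by have := ltn_ord j; rewrite E ltnNge leq_addl.
Qed.

Definition shift n s (A B : {set 'I_n}) (hA : #|A| = s) (hB : #|B| = s) : nat :=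
  ex_minn (good_shift_ex hA hB).

(* With indices starting from 0, the residue of i + l in {1, ..., s} becomes
   the usual residue in {0, ..., s - 1}, that is inZp (i + l) : 'I_s. *)
Definition Nset n k (A B : {set 'I_n}) (hA : #|A| = k.+1) (hB : #|B| = k.+1) :
    {set 'I_n * 'I_n} :=
  [set (elt hA (inZp (i + shift hA hB)), elt hB i) | i : 'I_k.+1].

Definition phi n (i j : 'I_n) : int :=
  let i1 : int := i.+1%:Z in
  let j1 : int := j.+1%:Z in
  (((2 - i1) * n%:Z + (j1 - 1) * (n%:Z - 1) - 1) %% (n%:Z ^+ 2))%Z + 1.

Lemma phi_inj n (i j k l : 'I_n) : phi i j = phi k l -> (i, j) = (k, l).
Proof.
case: n i j k l => [[]//|n] i j k l /addIr /eqP.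
rewrite eqz_mod_dvd => /dvdzP[q E].
have {}E : (k%:Z - i%:Z) * n.+1%:Z + (j%:Z - l%:Z) * n%:Z = q * n.+1%:Z ^+ 2.
  by rewrite -E; lia.
have dvd_small (a b : 'I_n.+1) : (n.+1%:Z %| a%:Z - b%:Z)%Z -> a = b.
  rewrite -eqz_mod_dvd !modz_nat => /eqP[].
  by rewrite !modn_small // => /val_inj.
have ejl : j = l.
  apply: dvd_small; apply/dvdzP; exists (k%:Z - i%:Z + j%:Z - l%:Z - q * n.+1%:Z).
  by lia.
have eki : k = i.
  apply: dvd_small; apply/dvdzP; exists q.
  apply: (@mulIf _ n.+1%:Z) => //.
  by rewrite -mulrA -expr2 -E ejl subrr mul0r addr0.
by rewrite ejl eki.
Qed.

Definition drl_lt n (m m' : 'X_{1..n * n}) : bool :=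
  (mdeg m < mdeg m')%N ||
  (mdeg m == mdeg m') &&
  [exists i : 'I_n, exists j : 'I_n,
     (m' (var i j) < m (var i j))%N &&
     [forall k : 'I_n, forall l : 'I_n,
        (phi k l < phi i j) ==> (m (var k l) == m' (var k l))]].

Definition drl_le n (m m' : 'X_{1..n * n}) : bool := (m == m') || drl_lt m m'.

(* m is the leading monomial of f; unique by is_lm_uniq, and f is then nonzero. *)
Definition is_lm (K : fieldType) n (f : {mpoly K[n * n]}) (m : 'X_{1..n * n}) :
    Prop :=
  m \in msupp f /\ forall m', m' \in msupp f -> drl_le m' m.

Lemma drl_le_anti n (m m' : 'X_{1..n * n}) :
  drl_le m m' -> drl_le m' m -> m = m'.
Proof.
case/orP=> [/eqP //|/orP lt1]; case/orP=> [/eqP //|/orP lt2].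
case: lt1 lt2 => [d1|/andP[/eqP d1 e1]] [d2|/andP[/eqP d2 e2]].
- by have := ltn_trans d1 d2; rewrite ltnn.
- by move: d1; rewrite d2 ltnn.
- by move: d2; rewrite d1 ltnn.
case/existsP: e1 => i /existsP[j /andP[lt1 /forallP eq1]].
case/existsP: e2 => k /existsP[l /andP[lt2 /forallP eq2]].
case: (ltgtP (phi i j) (phi k l)) => [lt|lt|/phi_inj[ei ej]].
- by have /forallP/(_ j) := eq2 i; rewrite lt /= => /eqP E; rewrite E ltnn in lt1.
- by have /forallP/(_ l) := eq1 k; rewrite lt /= => /eqP E; rewrite E ltnn in lt2.
- by rewrite ei ej in lt1; have := ltn_trans lt1 lt2; rewrite ltnn.
Qed.

Lemma is_lm_uniq (K : fieldType) n (f : {mpoly K[n * n]}) m1 m2 :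
  is_lm f m1 -> is_lm f m2 -> m1 = m2.
Proof. by move=> [f1 le1] [f2 le2]; apply: drl_le_anti; [apply: le2|apply: le1]. Qed.

(* Main.v *)
(** Read rows and columns modulo [n] and let each column [j] move forward to the
    first lift of its row in [(j, j + n]]. Then [phi] sorts the cells by
    decreasing length of the move, and by decreasing column among moves of
    equal length. A term of the minor is a permutation [s]; on indices it lifts
    to a periodic bijection of the integers, [i |-> s i + (k + 1) * wraps s i]
    on one period, whose mean displacement is the number of wrapping columns.
    This mean is at least [l = shift] for every [s], because some
    [a_(i+l-1) <= b_i] is a bottleneck, and the cyclic shift displaces every
    index by exactly [l]. If the smallest cell where [s] and the cyclic shift
    differ were the cell of the shift in column [i0], the lift of [s] would
    map every integer up to [i0] below [i0 + l], and its mean displacement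
    would be less than [l]. *)
Require Import Defs.
From mathcomp Require Import all_boot all_order all_fingroup all_algebra.
From mathcomp Require Import zify ring.
From mathcomp.multinomials Require Import mpoly.

Set Implicit Arguments.
Unset Strict Implicit.
Unset Printing Implicit Defensive.

Local Open Scope ring_scope.

Import Order.TTheory GRing.Theory.

Lemma ltn_add_mul d x y p q : (x < d)%N -> (y < d)%N ->
  (x + d * p < y + d * q)%N = ((p < q) || (p == q) && (x < y))%N.
Proof. by move=> ltxd ltyd; case: (ltngtP p q) => [ltpq|ltqp|->]; nia. Qed.

Lemma sum_ord_ltn m t : (t <= m)%N -> (\sum_(i < m) (i < t) = t)%N.
Proof.
move=> le_tm; transitivity (\sum_(i < m | (i < t)%N) 1)%N.
  by rewrite [RHS]big_mkcond; apply: eq_bigr => i _; case: ifP.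
by rewrite (big_ord_narrow le_tm) sum1_card card_ord.
Qed.

Section PeriodicBijection.

Variables (m : nat) (s : 'S_m) (p : 'I_m -> nat) (c : nat).

Lemma sum_divn_perm :
  (0 < m)%N -> (\sum_i (c %/ m + (s i < c %% m)) = c)%N.
Proof.
move=> m_gt0; rewrite big_split /= sum_nat_const card_ord.
rewrite -(reindex_inj (@perm_inj _ s) (P := xpredT)
  (F := fun j : 'I_m => (j < c %% m)%N : nat)) /=.
by rewrite sum_ord_ltn 1?ltnW ?ltn_mod // mulnC -divn_eq.
Qed.

Lemma leq_sum_periods :
  (0 < m)%N -> (forall i, c <= s i + m * p i)%N -> (c <= \sum_i p i)%N.
Proof.
move=> m_gt0 lec; rewrite -(sum_divn_perm m_gt0).
apply: leq_sum => i _; have := lec i; rewrite {1}(divn_eq c m) addnC mulnC.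
by rewrite leqNgt ltn_add_mul ?ltn_mod //; lia.
Qed.

Lemma sum_periods_leq :
  (forall i, s i + m * p i < c + m)%N -> (\sum_i p i <= c)%N.
Proof.
move=> ltc; have [m0|m_gt0] := posnP m.
  by rewrite big1 // => i; have := ltn_ord i; rewrite {2}m0.
rewrite -(sum_divn_perm m_gt0); move: ltc.
have -> : (c + m = c %% m + m * (c %/ m).+1)%N by rewrite {1}(divn_eq c m); lia.
move=> ltc; apply: leq_sum => i _; have := ltc i.
by rewrite ltn_add_mul ?ltn_mod //; lia.
Qed.

End PeriodicBijection.

(* The first lift of row [i] strictly beyond column [j]. *)
Definition landing n (i j : 'I_n) : nat := (i + n * (i <= j))%N.

Lemma phiE n (i j : 'I_n) :
  phi i j = ((j + n - landing i j) * n + (n - j))%N%:Z.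
Proof.
have lt_in := ltn_ord i; have lt_jn := ltn_ord j.
pose w : nat := ~~ (i <= j)%N.
pose d := (j + n * w - i)%N.
have [-> d_int lt_dn] : [/\ (j + n - landing i j = d)%N,
    d%:Z = j%:Z + n%:Z * w%:Z - i%:Z & (d < n)%N].
  rewrite /landing /d /w; case: leqP => /= ?; rewrite ?muln0 ?muln1.
    by split; lia.
  by split; lia.
rewrite /phi (_ : _ - 1 = - w%:Z * n%:Z ^+ 2 + (d * n + (n - j.+1))%N%:Z).
  by rewrite modzMDl modz_small; nia.
have -> : (d * n + (n - j.+1))%N%:Z = d%:Z * n%:Z + n%:Z - j%:Z - 1 by lia.
by rewrite d_int -!natr1; ring.
Qed.

Lemma landing_leq n (i j : 'I_n) : (landing i j <= j + n)%N.
Proof. by rewrite /landing; have := ltn_ord i; case: leqP => /=; lia. Qed.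

Lemma phi_ltE n (i j i0 j0 : 'I_n) :
  (phi i0 j0 < phi i j) =
    ((landing i j + j0 < landing i0 j0 + j)
     || (landing i j + j0 == landing i0 j0 + j) && (j < j0))%N.
Proof.
have lt_jn := ltn_ord j; have lt_j0n := ltn_ord j0.
have le_ij := landing_leq i j; have le_ij0 := landing_leq i0 j0.
rewrite !phiE ltz_nat -!(subnSK (ltn_ord _)) !addnS ltnS !(mulnC _ n).
by rewrite !(addnC (n * _)%N) ltn_add_mul; lia.
Qed.

Lemma phi_lt_landing n (i j i0 j0 : 'I_n) : phi i0 j0 < phi i j ->
  (landing i j < landing i0 j0 + n * (j0 < j))%N.
Proof.
have := ltn_ord j.
by rewrite phi_ltE; case: (ltnP j0 j) => /= ?; rewrite ?muln1; lia.
Qed.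

Definition cell_mnm n (S : {set 'I_n * 'I_n}) : 'X_{1..n * n} :=
  (\sum_(p in S) U_(var p.1 p.2))%MM.

Lemma var_eqE n (i j k l : 'I_n) : (var i j == var k l) = ((i, j) == (k, l)).
Proof. by rewrite (inj_eq (@cast_ord_inj _ _ _)) (inj_eq enum_rank_inj). Qed.

Lemma cell_mnmE n (S : {set 'I_n * 'I_n}) (i j : 'I_n) :
  cell_mnm S (var i j) = ((i, j) \in S).
Proof.
rewrite mnm_sumE.
under eq_bigr => p _ do rewrite mnm1E var_eqE -surjective_pairing.
have [ijS|ijNS] := boolP ((i, j) \in S).
  by rewrite (bigD1 (i, j)) //= eqxx big1 // => p /andP[_ /negbTE->].
by rewrite big1 // => p pS; case: eqP pS ijNS => // -> ->.
Qed.

Lemma cell_mnm_inj n : injective (@cell_mnm n).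
Proof.
move=> S T eq_ST; apply/setP => -[i j]; apply: (can_inj oddb).
by rewrite -!cell_mnmE eq_ST.
Qed.

Lemma mdeg_cell_mnm n (S : {set 'I_n * 'I_n}) : mdeg (cell_mnm S) = #|S|.
Proof.
by rewrite mdeg_sum -sum1_card; apply: eq_bigr => p _; rewrite mdeg1.
Qed.

Lemma drl_le_cell_mnm n (S T : {set 'I_n * 'I_n}) :
    #|S| = #|T| ->
    (forall p, p \in T :\: S ->
       exists2 q, q \in S :\: T & phi q.1 q.2 <= phi p.1 p.2) ->
  drl_le (cell_mnm S) (cell_mnm T).
Proof.
move=> eq_card smaller.
have [->|neST] := eqVneq S T; first by rewrite /drl_le eqxx.
have /set0Pn[p0 p0ST] : S :\: T != set0.
  apply: contraNneq neST => /eqP.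
  by rewrite setD_eq0 eqEcard eq_card leqnn andbT.
have [[i j] /setDP[ijS ijNT] min_ij] :=
  arg_minP (fun p : 'I_n * 'I_n => phi p.1 p.2) p0ST.
rewrite /drl_le /drl_lt !mdeg_cell_mnm eq_card ltnn eqxx /=; apply/orP; right.
apply/existsP; exists i; apply/existsP; exists j.
rewrite !cell_mnmE ijS (negbTE ijNT) /=.
apply/forallP => x; apply/forallP => y; apply/implyP => lt_xy.
rewrite !cell_mnmE.
have xyNST : (x, y) \notin S :\: T.
  by apply: contraL lt_xy => /min_ij; rewrite -leNgt.
have xyNTS : (x, y) \notin T :\: S.
  apply: contraL lt_xy => /smaller[q /min_ij le_ij_q le_q_xy].
  by rewrite -leNgt (le_trans le_ij_q).
by move: xyNST xyNTS; rewrite !inE; do 2!case: (_ \in _).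
Qed.

Lemma is_lm_sum (K : fieldType) n (I : finType) (c : I -> K)
    (m : I -> 'X_{1..n * n}) (i0 : I) :
    injective m -> c i0 != 0 -> (forall i, drl_le (m i) (m i0)) ->
  is_lm (\sum_i c i *: 'X_[m i]) (m i0).
Proof.
move=> m_inj c_neq0 m_le; split=> [|m' /msupp_sum_le/flatten_mapP[i _]].
  rewrite mcoeff_msupp raddf_sum (bigD1 i0) //= big1 => [|i ne_i].
    by rewrite addr0 mcoeffZ mcoeffX eqxx mulr1.
  by rewrite mcoeffZ mcoeffX (inj_eq m_inj) (negbTE ne_i) mulr0.
by move/msuppZ_le; rewrite msuppX inE => /eqP ->.
Qed.

Section Elt.

Variables (n s : nat) (A : {set 'I_n}) (hA : #|A| = s).

Lemma leq_elt : {mono elt hA : i j / (i <= j)%N}.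
Proof. exact: (@le_mono _ _ _ _ (elt hA) (@elt_lt _ _ _ hA)). Qed.

Lemma ltn_elt : {mono elt hA : i j / (i < j)%N}.
Proof. by move=> i j; rewrite !ltnNge leq_elt. Qed.

Lemma elt_inj : injective (elt hA).
Proof. exact: (inj_comp enum_val_inj (@cast_ord_inj _ _ _)). Qed.

Lemma ltn_elt_add_mul (i j : 'I_s) (p q : nat) :
  (elt hA i + n * p < elt hA j + n * q)%N = (i + s * p < j + s * q)%N.
Proof. by rewrite !ltn_add_mul // ltn_elt. Qed.

End Elt.

Section CyclicShift.

Variables (n k : nat) (A B : {set 'I_n}).
Hypotheses (hA : #|A| = k.+1) (hB : #|B| = k.+1).

Local Notation a := (elt hA).
Local Notation b := (elt hB).
Local Notation l := (shift hA hB).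

Lemma shift_leq : (l <= k.+1)%N.
Proof. by rewrite /shift; case: ex_minnP => l0 /andP[]. Qed.

Lemma elt_lt_shift (i j : 'I_k.+1) : (j = i + l :> nat)%N -> (b i < a j)%N.
Proof.
rewrite /shift; case: ex_minnP => l0 /andP[_ /forallP good _] /eqP.
by have /forallP/(_ j)/implyP := good i.
Qed.

Lemma shift_bottleneck : (0 < l)%N ->
  exists i j : 'I_k.+1, j.+1 = (i + l)%N /\ (a j <= b i)%N.
Proof.
rewrite /shift; case: ex_minnP => -[//|l0] /andP[lt_l0k _] min_l0 _.
have : ~~ good_shift hA hB l0 by apply/negP => /min_l0; rewrite ltnn.
rewrite /good_shift (ltnW lt_l0k) /= negb_forall => /existsP[i].
rewrite negb_forall => /existsP[j]; rewrite negb_imply -leqNgt.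
by case/andP=> /eqP j_eq le_ab; exists i, j; rewrite j_eq addnS.
Qed.

Definition wraps (s : 'S_k.+1) (i : 'I_k.+1) : bool := (a (s i) <= b i)%N.

Lemma shift_leq_sum_wraps (s : 'S_k.+1) : (l <= \sum_i wraps s i)%N.
Proof.
have [->//|/shift_bottleneck[i0 [j0 [j0_eq le_ab0]]]] := posnP l.
have le_i0k : (i0 <= k.+1)%N by apply: ltnW.
suff : (i0 + l <= \sum_i (wraps s i + (i < i0)))%N.
  by rewrite big_split /= sum_ord_ltn //; lia.
apply: (leq_sum_periods (s := s)) => // i; rewrite -j0_eq.
have lt_j0 := ltn_ord j0.
have [|lt_ba] := leqP (a (s i)) (b i); first by rewrite /wraps => ->; lia.
have [lt_ii0|le_i0i] := ltnP i i0; first by lia.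
rewrite ltn_addr // -(ltn_elt hA).
by apply: leq_ltn_trans le_ab0 (leq_ltn_trans _ lt_ba); rewrite leq_elt.
Qed.

Lemma add_shift_inj : injective (fun i : 'I_k.+1 => inZp (i + l) : 'I_k.+1).
Proof.
move=> i j /(congr1 val) /= /eqP; rewrite eqn_modDr !modn_small // => /eqP.
exact: val_inj.
Qed.

Definition shift_perm : 'S_k.+1 := perm add_shift_inj.

Lemma wraps_shift_perm (i : 'I_k.+1) : wraps shift_perm i = (k.+1 <= i + l)%N.
Proof.
have lt_ik := ltn_ord i; have le_lk := shift_leq.
rewrite /wraps permE; have [lt_ilk|le_kil] := ltnP (i + l) k.+1.
  by apply/negbTE; rewrite -ltnNge elt_lt_shift //= modn_small.
have [|i0 [j0 [j0_eq le_ab0]]] := shift_bottleneck; first by lia.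
have lt_j0k := ltn_ord j0.
apply: leq_trans (_ : _ <= a j0)%N (leq_trans le_ab0 _); rewrite leq_elt.
  by rewrite /= -(subnK le_kil) modnDr modn_small; lia.
by lia.
Qed.

Lemma lift_shift_perm (i : 'I_k.+1) :
  (shift_perm i + k.+1 * wraps shift_perm i = i + l)%N.
Proof.
have lt_ik := ltn_ord i; have le_lk := shift_leq.
rewrite wraps_shift_perm permE /=; case: (leqP k.+1 (i + l)) => [le_kil|lt_ilk].
  by rewrite -{1}(subnK le_kil) modnDr modn_small; lia.
by rewrite modn_small //; lia.
Qed.

Section SmallestDifference.

Variables (s : 'S_k.+1) (i0 : 'I_k.+1).
Hypothesis diff_i0 : s i0 != shift_perm i0.
Hypothesis phi_lt_diff : forall i, s i != shift_perm i ->
  phi (a (shift_perm i0)) (b i0) < phi (a (s i)) (b i).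

Lemma lift_lt_add_shift (i : 'I_k.+1) :
  (s i + k.+1 * wraps s i < i0 + l + k.+1 * (i0 < i))%N.
Proof.
have [agree_i|/phi_lt_diff/phi_lt_landing] := eqVneq (s i) (shift_perm i).
  have ne_i : i != i0 :> nat.
    by apply: contraNneq diff_i0 => /val_inj <-; apply/eqP.
  rewrite /wraps agree_i lift_shift_perm.
  have lt_ik := ltn_ord i.
  by case: (ltngtP i i0) ne_i => //= ? _; rewrite ?muln1; lia.
rewrite /landing -addnA -mulnDr ltn_elt_add_mul mulnDr addnA lift_shift_perm.
by rewrite ltn_elt.
Qed.

Lemma sum_wraps_lt_shift : (\sum_i wraps s i < l)%N.
Proof.
suff : (\sum_i (wraps s i + (i < i0.+1)) <= i0 + l)%N.
  by rewrite big_split /= sum_ord_ltn // addnC addSn -addnS leq_add2l.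
apply: (sum_periods_leq (s := s)) => i; have := lift_lt_add_shift i.
by case: (leqP i i0); lia.
Qed.

End SmallestDifference.

Lemma exists_phi_le_shift_perm (s : 'S_k.+1) (i0 : 'I_k.+1) :
    s i0 != shift_perm i0 ->
  exists2 i, s i != shift_perm i &
    phi (a (s i)) (b i) <= phi (a (shift_perm i0)) (b i0).
Proof.
move=> diff_i0; apply/exists_inP; apply: contraLR (shift_leq_sum_wraps s).
move/exists_inPn => phi_gt; rewrite -ltnNge.
by apply: sum_wraps_lt_shift diff_i0 _ => i /phi_gt; rewrite -ltNge.
Qed.

Definition perm_cells (s : 'S_k.+1) : {set 'I_n * 'I_n} :=
  [set (a (s i), b i) | i : 'I_k.+1].

Lemma mem_perm_cells (s : 'S_k.+1) (i j : 'I_k.+1) :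
  ((a i, b j) \in perm_cells s) = (s j == i).
Proof.
apply/imsetP/eqP => [[j' _ [/elt_inj -> /elt_inj ->]] //|<-].
by exists j.
Qed.

Lemma perm_cells_inj : injective perm_cells.
Proof.
move=> s t eq_st; apply/permP => j; apply/eqP.
by rewrite -mem_perm_cells eq_st mem_perm_cells.
Qed.

Lemma card_perm_cells (s : 'S_k.+1) : #|perm_cells s| = k.+1.
Proof. by rewrite card_imset ?card_ord // => i j [_ /elt_inj]. Qed.

Lemma Nset_perm_cells : Nset hA hB = perm_cells shift_perm.
Proof. by apply: eq_imset => i; rewrite permE. Qed.

End CyclicShift.

Lemma det_submat (K : fieldType) n k (A B : {set 'I_n})
    (hA : #|A| = k.+1) (hB : #|B| = k.+1) :
  \det (submat K hA hB) =
  \sum_(s : 'S_k.+1) (-1) ^+ s *: 'X_[cell_mnm (perm_cells hA hB s)].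
Proof.
rewrite -det_tr; apply: eq_bigr => s _; rewrite scaler_sign -mulr_sign.
congr (_ * _); rewrite /cell_mnm big_imset => [|i j _ _ [_ /elt_inj] //].
rewrite (big_morph _ (@mpolyXD _ K) (@mpolyX0 _ K)).
by apply: eq_bigr => i _; rewrite !mxE.
Qed.

Theorem theorem7p2 (K : fieldType) (n k : nat) (hn : (1 <= n)%N) (hk : (k < n)%N)
    (A B : {set 'I_n}) (hA : #|A| = k.+1) (hB : #|B| = k.+1) :
  is_lm (\det (submat K hA hB))
        (\sum_(p in Nset hA hB) U_(var p.1 p.2))%MM.
Proof.
rewrite det_submat Nset_perm_cells.
apply: (is_lm_sum (m := fun s => cell_mnm (perm_cells hA hB s))) => [||s].
- exact: inj_comp (@cell_mnm_inj n) (@perm_cells_inj _ _ _ _ hA hB).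
- by rewrite signr_eq0.
apply: drl_le_cell_mnm; first by rewrite !card_perm_cells.
move=> _ /setDP[/imsetP[i0 _ ->]]; rewrite mem_perm_cells.
case/exists_phi_le_shift_perm=> i diff_i le_phi.
exists (elt hA (s i), elt hB i) => //.
by rewrite inE !mem_perm_cells eqxx andbT eq_sym.
Qed.
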